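(* Let $n\ge1$, $d_1>0$, let $b=b_1\cdots b_n\in\Delta_n=\{1,2,4,7\}^n$, let $\varnothing\ne S\subseteq\operatorname{supp}(b)$, and define $b^{(t)}:=\gamma_S^t(b)$ for $t=0,1,2$. Define the word $c=c(b,S)\in\Delta_n$ coordinatewise by $c_r=7$ if $r\in S$ and $c_r=b_r$ if $r\notin S$. Then the following hold. \begin{enumerate} \item The points $P(b^{(0)}),P(b^{(1)}),P(b^{(2)})$ are the vertices of a nondegenerate equilateral triangle. \item If $\nu(b):=\#\{r:b_r\ne7\}$, then the cyclically ordered product is $$b^{(0)}b^{(1)}b^{(2)}=(-1)^{\nu(b)}c.$$ \item The Euclidean center of the triangle is $$Q=\sum_{r\notin S}\sigma_r(b)\,d_r\,v(b_r).$$ \item One has $P(c)=Q$ if and only if $$\#\{s\in S:s<r\}\equiv0\pmod 2$$ for every $r\notin S$ such that $b_r\ne7$. \end{enumerate}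
   Context: Digits are identified with quaternionic symbols: $1=i$, $2=j$, $4=k$, $7=e$, where $e$ is the identity, $i^2=j^2=k^2=-e$, $ij=k=-ji$, $jk=i=-kj$, $ki=j=-ik$. Words in $\Delta_n$ are multiplied coordinate by coordinate, with the local signs collected into one global sign: if $b_rc_r=\varepsilon_rd'_r$ with $\varepsilon_r\in\{\pm1\}$ and $d'_r\in\{1,2,4,7\}$, then $bc=(\prod_r\varepsilon_r)\,d'_1\cdots d'_n$; this extends to signed words $\pm b$. The support is $\operatorname{supp}(b)=\{r\in\{1,\dots,n\}:b_r\ne7\}$. For $S\subseteq\{1,\dots,n\}$, $\gamma_S:\Delta_n\to\Delta_n$ applies the cycle $1\mapsto2\mapsto4\mapsto1$ (fixing $7$) in the coordinates belonging to $S$ and leaves all other coordinates unchanged. The vectors in $\mathbb R^2$ are $v(1)=(\cos 210^\circ,\sin 210^\circ)$, $v(2)=(\cos 90^\circ,\sin 90^\circ)$, $v(4)=(\cos 330^\circ,\sin 330^\circ)$, $v(7)=(0,0)$. For a fixed scale $d_1>0$ put $d_r=d_1/2^{r-1}$. For $b\in\Delta_n$ put $\sigma_r(b)=(-1)^{\#\{s<r:\,b_s=7\}}$; the centroid map is $P(b)=\sum_{r=1}^n\sigma_r(b)\,d_r\,v(b_r)$. *)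

(* Defs.v *)
From HB Require Import structures.
From mathcomp Require Import all_boot all_order all_algebra.
From mathcomp Require Import reals trigo.

Set Implicit Arguments.
Unset Strict Implicit.
Unset Printing Implicit Defensive.

Import Order.TTheory GRing.Theory Num.Theory.

Local Open Scope ring_scope.

Inductive digit : Type := D1 | D2 | D4 | D7.

Definition nat_of_digit (a : digit) : nat :=
  match a with D1 => 1 | D2 => 2 | D4 => 4 | D7 => 7 end.

Definition digit_of_nat (m : nat) : digit :=
  match m with 1 => D1 | 2 => D2 | 4 => D4 | _ => D7 end.

Lemma nat_of_digitK : cancel nat_of_digit digit_of_nat.
Proof. by case. Qed.

HB.instance Definition _ := Equality.copy digit (can_type nat_of_digitK).

(* Coordinates are numbered from 0: [r : 'I_n] stands for position r + 1. *)
Definition word (n : nat) : Type := {ffun 'I_n -> digit}.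

(* Quaternion units, with D1 = i, D2 = j, D4 = k, D7 = e: the pair (eps, d)
   stands for eps * d, where eps = 1 or -1. *)
Definition digit_mul (a b : digit) : int * digit :=
  match a, b with
  | D7, x => (1, x)
  | x, D7 => (1, x)
  | D1, D1 | D2, D2 | D4, D4 => (-1, D7)
  | D1, D2 => (1, D4)
  | D2, D1 => (-1, D4)
  | D2, D4 => (1, D1)
  | D4, D2 => (-1, D1)
  | D4, D1 => (1, D2)
  | D1, D4 => (-1, D2)
  end.

(* The pair (eps, b) is the signed word eps b; only eps = 1 and eps = -1
   are meaningful. *)
Definition signed_word (n : nat) : Type := (int * word n)%type.

Definition pos_word (n : nat) (b : word n) : signed_word n := (1, b).

Definition signed_mul (n : nat) (x y : signed_word n) : signed_word n :=
  (x.1 * y.1 * \prod_(r < n) (digit_mul (x.2 r) (y.2 r)).1,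
   [ffun r => (digit_mul (x.2 r) (y.2 r)).2]).

Definition word_supp (n : nat) (b : word n) : {set 'I_n} := [set r | b r != D7].

Definition word_nu (n : nat) (b : word n) : nat := #|[set r | b r != D7]|.

Definition digit_cycle (a : digit) : digit :=
  match a with D1 => D2 | D2 => D4 | D4 => D1 | D7 => D7 end.

Definition word_gamma (n : nat) (S : {set 'I_n}) (b : word n) : word n :=
  [ffun r => if r \in S then digit_cycle (b r) else b r].

Definition word_gamma_iter (n : nat) (b : word n) (S : {set 'I_n}) (t : nat) :
  word n := iter t (word_gamma S) b.

Definition center_word (n : nat) (b : word n) (S : {set 'I_n}) : word n :=
  [ffun r => if r \in S then D7 else b r].

Section Plane.
Variable R : realType.

Definition plane_point (x y : R) : 'rV[R]_2 := \row_(j < 2) if j == 0 then x else y.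

Definition degrees (x : R) : R := x * pi / 180.

Definition polar_point (x : R) : 'rV[R]_2 := plane_point (cos (degrees x)) (sin (degrees x)).

Definition digit_vec (a : digit) : 'rV[R]_2 :=
  match a with
  | D1 => polar_point 210
  | D2 => polar_point 90
  | D4 => polar_point 330
  | D7 => plane_point 0 0
  end.

(* With numbering from 0, d_r = d_1 / 2^(r-1) becomes d1 / 2 ^+ r. *)
Definition side_scale (d1 : R) (r : nat) : R := d1 / 2 ^+ r.

Definition word_sigma (n : nat) (b : word n) (r : 'I_n) : R :=
  (-1) ^+ #|[set s : 'I_n | (s < r)%N && (b s == D7)]|.

Definition centroid_map (n : nat) (d1 : R) (b : word n) : 'rV[R]_2 :=
  \sum_(r < n) (word_sigma b r * side_scale d1 r) *: digit_vec (b r).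

(* The norm of the library on 'rV[R]_2 is the sup norm. *)
Definition eucl_dist (A B : 'rV[R]_2) : R :=
  Num.sqrt (\sum_(j < 2) (A 0 j - B 0 j) ^+ 2).

Definition triangle_nondegenerate (A B C : 'rV[R]_2) : Prop :=
  row_free (col_mx (B - A) (C - A)).

Definition triangle_equilateral (A B C : 'rV[R]_2) : Prop :=
  eucl_dist A B = eucl_dist B C /\ eucl_dist B C = eucl_dist C A.

(* For an equilateral triangle the barycenter and the circumcenter coincide;
   Q is required to be both. *)
Definition is_triangle_center (A B C Q : 'rV[R]_2) : Prop :=
  Q = 3^-1 *: (A + B + C) /\ eucl_dist Q A = eucl_dist Q B /\ eucl_dist Q B = eucl_dist Q C.

End Plane.

(* Main.v *)
(** The signs [word_sigma] only depend on the positions of the digit 7, which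
    [word_gamma] does not move, and the 3-cycle of the digits 1, 2, 4 is the
    rotation of angle -120 degrees of their vectors.  Hence the three centroids
    are [Q + w], [Q + w rot], [Q + w rot^2], where [w] is the part of the sum
    carried by [S].  A nonempty signed dyadic sum of unit vectors never vanishes,
    its first term being longer than all the others together.  This gives
    [w <> 0], and also the converse of the last item: replacing the digits in [S]
    by 7 multiplies the sign at [r] by [-1] to the number of elements of [S]
    before [r], so that [P(c) - Q] is twice such a sum over the bad positions. *)
Require Import Defs.
From mathcomp Require Import all_boot all_order all_algebra.
From mathcomp Require Import reals trigo ring lra.
Set Implicit Arguments.
Unset Strict Implicit.
Unset Printing Implicit Defensive.
Import Order.TTheory GRing.Theory Num.Theory.
Local Open Scope ring_scope.

(** * Quaternion products, one coordinate at a time *)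

Lemma digit_mul_cycle (a : digit) (x := digit_mul a (digit_cycle a))
    (y := digit_mul x.2 (digit_cycle (digit_cycle a))) :
  x.1 * y.1 = (if a != D7 then -1 else 1) /\ y.2 = D7.
Proof. by rewrite {}/y {}/x; case: a. Qed.

Lemma digit_mul_cube (a : digit) (x := digit_mul a a) (y := digit_mul x.2 a) :
  x.1 * y.1 = (if a != D7 then -1 else 1) /\ y.2 = a.
Proof. by rewrite {}/y {}/x; case: a. Qed.

Lemma word_gamma_iterE (n : nat) (b : word n) (S : {set 'I_n}) (t : nat) r :
  word_gamma_iter b S t r = if r \in S then iter t digit_cycle (b r) else b r.
Proof.
rewrite /word_gamma_iter; elim: t => [|t IHt] /=; first by rewrite if_same.
by rewrite ffunE IHt; case: (r \in S).
Qed.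

(** Every coordinate of the support contributes one sign: in [S] because [ijk = jki = kij = -e],
    outside [S] because an imaginary unit has cube [-a]. So the global sign does not depend on
    [S]. *)
Lemma word_gamma_prod (n : nat) (b : word n) (S : {set 'I_n}) :
  signed_mul
    (signed_mul (pos_word (word_gamma_iter b S 0))
       (pos_word (word_gamma_iter b S 1)))
    (pos_word (word_gamma_iter b S 2)) = ((-1) ^+ word_nu b, center_word b S).
Proof.
move: (word_gamma_iterE b S 0) (word_gamma_iterE b S 1) (word_gamma_iterE b S 2).
move: (word_gamma_iter b S 0) (word_gamma_iter b S 1) => b0 b1.
move: (word_gamma_iter b S 2) => b2 /= b0E b1E b2E.
rewrite /signed_mul /=; congr (_, _); last first.
  apply/ffunP => r; rewrite !ffunE b0E b1E b2E.
  by case: (r \in S); [case: (digit_mul_cycle (b r)) | case: (digit_mul_cube (b r))].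
rewrite !mul1r mulr1 -big_split /= /word_nu -prodr_const [RHS]big_mkcond /=.
apply: eq_bigr => r _; rewrite inE ffunE b0E b1E b2E.
by case: (r \in S); [case: (digit_mul_cycle (b r)) | case: (digit_mul_cube (b r))].
Qed.

Lemma iter_digit_cycle_eq7 (t : nat) (a : digit) :
  (iter t digit_cycle a == D7) = (a == D7).
Proof. by elim: t => //= t <-; case: (iter t digit_cycle a). Qed.

Section Plane.
Variable R : realType.
Implicit Types (v w A B Q : 'rV[R]_2) (a : digit).

(** * Coordinates of the digit vectors, and the rotation *)

Lemma plane_point0 (x y : R) : plane_point x y 0 0 = x.
Proof. by rewrite mxE. Qed.

Lemma plane_point1 (x y : R) : plane_point x y 0 1 = y.
Proof. by rewrite mxE. Qed.

Lemma plane_pointP v w : v 0 0 = w 0 0 -> v 0 1 = w 0 1 -> v = w.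
Proof.
move=> e0 e1; apply/rowP => j.
by case: (unliftP 0 j) => [k|] -> //; rewrite ord1 (_ : lift 0 0 = 1) //; apply: val_inj.
Qed.

Lemma sum_ord2 (f : 'I_2 -> R) : \sum_(j < 2) f j = f 0 + f 1.
Proof. by rewrite !big_ord_recl big_ord0 addr0; congr (_ + f _); apply: val_inj. Qed.

Let c : R := cos (pi / 6).

Let c_gt0 : 0 < c.
Proof.
by apply: cos_gt0_pihalf; have := @pi_gt0 R; move=> ?; apply/andP; split; lra.
Qed.

Let s_gt0 : 0 < sin (pi / 6 : R).
Proof.
by apply: sin_gt0_pi; have := @pi_gt0 R; move=> ?; apply/andP; split; lra.
Qed.

(* Triple angle: [0 = cos (3 * (pi / 6)) = c (4 c ^+ 2 - 3)]. *)
Lemma sqr_cos_pi6 : c ^+ 2 = 3 / 4.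
Proof.
have h := cos2Dsin2 (pi / 6 : R); rewrite -/c in h.
have : cos (pi / 6 + (pi / 6 + pi / 6) : R) = 0.
  by rewrite -cos_pihalf; congr cos; field.
rewrite cosD (cosD (pi / 6)) (sinD (pi / 6)) -/c => e.
have {e} : c * (4 * c ^+ 2 - 3) = 0.
  by have := congr1 ( *%R c) h; lra.
by move/eqP; rewrite mulf_eq0 gt_eqF //= => /eqP ?; lra.
Qed.

(** Instances at suitable monomials [t] make later goals linear in their monomials, within reach of
    [lra]. *)
Let mul_sqr_cos t : t * c ^+ 2 = t * (3 / 4).
Proof. by rewrite sqr_cos_pi6. Qed.

Lemma sin_pi6 : sin (pi / 6 : R) = 1 / 2.
Proof.
have := cos2Dsin2 (pi / 6 : R); rewrite -/c sqr_cos_pi6 => h.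
(* The square of the sine is [1 / 4]; positivity selects the root. *)
have := s_gt0; nra.
Qed.

Lemma digit_vecE a : digit_vec R a = match a with
  | D1 => plane_point (- c) (- (1 / 2))
  | D2 => plane_point 0 1
  | D4 => plane_point c (- (1 / 2))
  | D7 => 0
  end.
Proof.
case: a; rewrite /= /polar_point /degrees.
- rewrite (_ : 210 * pi / 180 = pi / 6 + pi); last by field.
  by rewrite cosDpi sinDpi sin_pi6.
- rewrite (_ : 90 * pi / 180 = pi / 2); last by field.
  by rewrite cos_pihalf sin_pihalf.
- rewrite (_ : 330 * pi / 180 = - (pi / 6) + pi + pi); last by field.
  by rewrite !cosDpi !sinDpi cosN sinN sin_pi6 !opprK.
- by apply/rowP => j; rewrite !mxE if_same.
Qed.

(* Rotation of angle -120 degrees, acting on row vectors. *)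
Definition rot120 : 'M[R]_2 :=
  \matrix_(i, j) if i == j then - (1 / 2) else if i == 0 then - c else c.

Lemma mul_rot120 v :
  v *m rot120 =
  plane_point (- (1 / 2) * v 0 0 + c * v 0 1) (- c * v 0 0 - 1 / 2 * v 0 1).
Proof.
by apply: plane_pointP; rewrite ?plane_point0 ?plane_point1 !mxE sum_ord2 !mxE /=; ring.
Qed.

Lemma digit_vec_cycle a : digit_vec R (digit_cycle a) = digit_vec R a *m rot120.
Proof.
have c2 := sqr_cos_pi6.
case: a; rewrite ?digit_vecE ?mul0mx // mul_rot120.
all: by apply: plane_pointP; rewrite !(plane_point0, plane_point1); nra.
Qed.

Lemma digit_vec_iter_cycle (t : nat) a :
  digit_vec R (iter t digit_cycle a) = digit_vec R a *m rot120 ^+ t.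
Proof.
elim: t => [|t IHt] /=; first by rewrite mulmx1.
by rewrite digit_vec_cycle IHt exprSr mulmxA.
Qed.

Lemma rot120_sum v : v + v *m rot120 + v *m rot120 *m rot120 = 0.
Proof.
apply: plane_pointP; rewrite !mul_rot120 mxE [X in X + _]mxE !(plane_point0, plane_point1) mxE.
  by have := mul_sqr_cos (v 0 0); lra.
by have := mul_sqr_cos (v 0 1); lra.
Qed.

(** Compare the relation [1 + rot + rot^2 = 0] at [v] with the same relation at [v *m rot120]. *)
Lemma rot120_cube v : v *m rot120 *m rot120 *m rot120 = v.
Proof.
have /eqP := rot120_sum (v *m rot120); rewrite addr_eq0 -subr_eq0 opprK => /eqP h.
apply: (addrI (v *m rot120 + v *m rot120 *m rot120)); rewrite h.
by rewrite addrC addrA rot120_sum.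
Qed.

(** * Euclidean geometry of an orbit of the rotation *)

Definition dot v w : R := v 0 0 * w 0 0 + v 0 1 * w 0 1.

Lemma eucl_distE A B : eucl_dist A B = Num.sqrt (dot (A - B) (A - B)).
Proof. by rewrite /eucl_dist sum_ord2 /dot !mxE -!expr2. Qed.

Lemma dot_rot120 v w : dot (v *m rot120) (w *m rot120) = dot v w.
Proof.
rewrite /dot !mul_rot120 !(plane_point0, plane_point1).
have := mul_sqr_cos (v 0 0 * w 0 0); have := mul_sqr_cos (v 0 1 * w 0 1); lra.
Qed.

Lemma eucl_distDl Q A B : eucl_dist (Q + A) (Q + B) = eucl_dist A B.
Proof. by rewrite !eucl_distE opprD addrACA subrr add0r. Qed.

Lemma eucl_dist_rot120 A B :
  eucl_dist (A *m rot120) (B *m rot120) = eucl_dist A B.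
Proof. by rewrite !eucl_distE -mulmxBl dot_rot120. Qed.

Lemma dot_eq0 v : dot v v = 0 -> v = 0.
Proof.
rewrite /dot -!expr2 => /eqP; rewrite paddr_eq0 ?sqr_ge0 // !sqrf_eq0.
by move=> /andP[/eqP h0 /eqP h1]; apply: plane_pointP; rewrite mxE.
Qed.

Lemma rot120_nondegenerate Q w : w != 0 ->
  triangle_nondegenerate (Q + w) (Q + w *m rot120) (Q + w *m rot120 *m rot120).
Proof.
move=> w0; rewrite /triangle_nondegenerate !(addrC Q (_ *m _)) !addrKA.
have det_neq0 : w 0 0 ^+ 2 + w 0 1 ^+ 2 != 0.
  by apply: contra_neq w0 => h; apply: dot_eq0; rewrite /dot -!expr2.
have c0 : c != 0 by rewrite gt_eqF.
(* A vanishing combination of the two edge vectors, with coefficients [p] and [q], is a linear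
   system of two equations. *)
apply: inj_row_free => u; rewrite -(hsubmxK u) mul_row_col.
rewrite (mx11_scalar (lsubmx u)) (mx11_scalar (rsubmx u)) !mul_scalar_mx.
move: (lsubmx u 0 0) (rsubmx u 0 0) => p q /rowP pq0.
have := pq0 0; have := pq0 1; rewrite !mul_rot120 !mxE /=.
move: (w 0 0) (w 0 1) det_neq0 => x y xy0 e1 e0.
have {}e0 : p * (- (3 / 2) * x + c * y) + q * (- (3 / 2) * x - c * y) = 0.
  by have := mul_sqr_cos (q * x); lra.
have {}e1 : p * (- c * x - 3 / 2 * y) + q * (c * x - 3 / 2 * y) = 0.
  by have := mul_sqr_cos (q * y); lra.
(* Cramer: the determinant of this system is [- 3 c (x ^+ 2 + y ^+ 2)]. *)
have p0 : p = 0.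
  apply: (mulIf (mulf_neq0 c0 xy0)).
  have := congr1 ( *%R (c * x - 3 / 2 * y)) e0.
  by have := congr1 ( *%R (- (3 / 2) * x - c * y)) e1; lra.
have q0 : q = 0.
  apply: (mulIf (mulf_neq0 c0 xy0)).
  have := congr1 ( *%R (- c * x - 3 / 2 * y)) e0.
  by have := congr1 ( *%R (- (3 / 2) * x + c * y)) e1; lra.
by rewrite p0 q0 !raddf0 row_mx0.
Qed.

Lemma rot120_equilateral Q w :
  triangle_equilateral (Q + w) (Q + w *m rot120) (Q + w *m rot120 *m rot120).
Proof.
rewrite /triangle_equilateral !eucl_distDl !eucl_dist_rot120; split=> //.
(* Writing the last [w] as its image under the cubed rotation exhibits the closing side as a rotated
   copy of the first. *)
by rewrite -[X in _ = eucl_dist _ X]rot120_cube !eucl_dist_rot120.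
Qed.

Lemma rot120_center Q w :
  is_triangle_center (Q + w) (Q + w *m rot120) (Q + w *m rot120 *m rot120) Q.
Proof.
have dQ A : eucl_dist Q (Q + A *m rot120) = eucl_dist Q (Q + A).
  by rewrite -{1 3}[Q]addr0 !eucl_distDl -(eucl_dist_rot120 0 A) mul0mx.
split; last by rewrite !dQ.
rewrite (addrACA Q) (addrACA (Q + Q)) rot120_sum addr0.
by rewrite -mulr2n -mulrSr -scaler_nat scalerA mulVf ?scale1r // pnatr_eq0.
Qed.

(** * Signed dyadic sums of unit vectors *)

Lemma dot_digit_vec a : a != D7 -> dot (digit_vec R a) (digit_vec R a) = 1.
Proof.
have c2 := sqr_cos_pi6.
by case: a => // _; rewrite !digit_vecE /dot !(plane_point0, plane_point1); nra.
Qed.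

Lemma dot_digit_vec_le a a' : `|dot (digit_vec R a) (digit_vec R a')| <= 1.
Proof.
have c2 := sqr_cos_pi6; rewrite ler_norml.
by case: a; case: a'; rewrite !digit_vecE /dot ?(plane_point0, plane_point1, mxE);
  apply/andP; split; nra.
Qed.

(** The finite tail falls short of [2^-m] by exactly [2^-(n-1)], whence the strict inequality. *)
Lemma geometric_tail (m n : nat) : (m < n)%N ->
  \sum_(r < n | (m < r)%N) (2 ^+ r)^-1 < (2 ^+ m)^-1 :> R.
Proof.
move=> /subnKC <-.
suff -> : \sum_(r < m.+1 + (n - m.+1) | (m < r)%N) (2 ^+ r)^-1
    = (2 ^+ m)^-1 - (2 ^+ (m + (n - m.+1)))^-1 :> R.
  by rewrite ltrBlDr ltrDl invr_gt0 exprn_gt0.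
elim: (n - m.+1)%N => [|k IHk].
  by rewrite big1 ?addn0 ?subrr // => r; rewrite ltnNge -ltnS ltn_ord.
rewrite addnS big_mkcond big_ord_recr -big_mkcond /= IHk addSn ltnS leq_addr.
by rewrite addnS exprS invfM; lra.
Qed.

Lemma dyadic_sum_eq0 (n : nat) (b : word n) (T : {set 'I_n}) (a : R) (e : 'I_n -> R) :
  a != 0 -> T \subset word_supp b -> (forall r, `|e r| = 1) ->
  \sum_(r in T) (e r * side_scale a r) *: digit_vec R (b r) = 0 -> T = set0.
Proof.
move=> a0 sTb e1 sum0; apply: contra_eq (sum0) => /set0Pn[i0 Ti0].
case: (arg_minnP (fun r : 'I_n => val r) Ti0) => m Tm min_m.
(* Projecting on the direction of the term of least index [m] turns the vector equation into one
   between reals, where that term keeps its full length. *)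
set u := digit_vec R (b m).
apply/eqP => {}sum0.
pose x r := e r * side_scale a r * dot u (digit_vec R (b r)).
have sx0 : \sum_(r in T) x r = 0.
  transitivity (dot u (\sum_(r in T) (e r * side_scale a r) *: digit_vec R (b r))).
    rewrite /dot !summxE !mulr_sumr -big_split; apply: eq_bigr => r _ /=.
    by rewrite !mxE /x /dot; ring.
  by rewrite sum0 /dot !mxE !mulr0 addr0.
have normx r : `|x r| = `|a| / 2 ^+ r * `|dot u (digit_vec R (b r))|.
  by rewrite !normrM e1 mul1r normfV normrX normr_nat.
have xm : `|x m| = `|a| / 2 ^+ m.
  have bm : b m != D7 by have := subsetP sTb m Tm; rewrite inE.
  by rewrite normx dot_digit_vec // normr1 mulr1.
have : `|x m| < `|x m|.
  rewrite {1}(_ : x m = - \sum_(r in T | r != m) x r); last first.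
    by apply/eqP; rewrite -addr_eq0; move: sx0; rewrite (bigD1 m) //= => ->.
  rewrite normrN (le_lt_trans (ler_norm_sum _ _ _)) // xm.
  have := geometric_tail (ltn_ord m).
  rewrite -(ltr_pM2l (x := `|a|)) ?normr_gt0 //; apply: le_lt_trans.
  (* By minimality of [m] the other indices of [T] all exceed [m]; the indices beyond [m] outside
     [T] only add nonnegative terms to the bound. *)
  rewrite mulr_sumr big_mkcond [leRHS]big_mkcond; apply: ler_sum => r _.
  have [/andP[Tr rm]|_] := ifP; last first.
    by case: ifP => // _; rewrite mulr_ge0 // invr_ge0 exprn_ge0.
  rewrite ltn_neqAle eq_sym rm min_m //= normx.
  by rewrite ler_piMr ?dot_digit_vec_le // mulr_ge0 // invr_ge0 exprn_ge0.
by rewrite ltxx.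
Qed.

(** * Centroids of the rotated words and of the center word *)

Lemma word_sigma_norm (n : nat) (b : word n) r : `|word_sigma R b r| = 1.
Proof. by rewrite normrX normrN1 expr1n. Qed.

Lemma centroid_gamma_iter (n : nat) (d1 : R) (b : word n) (S : {set 'I_n}) (t : nat) :
  centroid_map d1 (word_gamma_iter b S t) =
  \sum_(r | r \notin S) (word_sigma R b r * side_scale d1 r) *: digit_vec R (b r)
  + (\sum_(r in S) (word_sigma R b r * side_scale d1 r) *: digit_vec R (b r))
      *m rot120 ^+ t.
Proof.
have sigmaE r : word_sigma R (word_gamma_iter b S t) r = word_sigma R b r.
  rewrite /word_sigma; congr (_ ^+ #|pred_of_set _|); apply/setP => s.
  by rewrite !inE word_gamma_iterE; case: (s \in S); rewrite ?iter_digit_cycle_eq7.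
rewrite /centroid_map (bigID (mem S)) /= addrC mulmx_suml.
congr (_ + _); apply: eq_bigr => r; rewrite sigmaE word_gamma_iterE.
  by move=> /negbTE ->.
by move=> ->; rewrite digit_vec_iter_cycle scalemxAl.
Qed.

(** The digits 7 of [center_word b S] before [r] are those of [b] together with the elements of [S]
    before [r]; the two sets are disjoint since [S] lies in the support. *)
Lemma word_sigma_center (n : nat) (b : word n) (S : {set 'I_n}) r :
  S \subset word_supp b ->
  word_sigma R (center_word b S) r =
  word_sigma R b r * (-1) ^+ #|[set s in S | (s < r)%N]|.
Proof.
move=> /subsetP sSb; rewrite /word_sigma -exprD -cardsUI.
rewrite [X in (_ + #|pred_of_set X|)%N](_ : _ = set0) ?cards0 ?addn0.
  congr (_ ^+ #|pred_of_set _|); apply/setP => s.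
  by rewrite !inE ffunE; case: (s \in S); case: (s < r)%N; rewrite ?orbF ?orbT.
apply/setP => s; rewrite !inE; apply/negP => /andP[/andP[_ bs] /andP[/sSb]].
by rewrite inE bs.
Qed.

Lemma centroid_center_word (n : nat) (d1 : R) (b : word n) (S : {set 'I_n}) :
  S \subset word_supp b ->
  centroid_map d1 (center_word b S) =
  \sum_(r | r \notin S)
    (word_sigma R b r * (-1) ^+ #|[set s in S | (s < r)%N]| * side_scale d1 r)
      *: digit_vec R (b r).
Proof.
move=> sSb; rewrite /centroid_map (bigID (mem S)) /= big1 ?add0r => [|r Sr].
  by apply: eq_bigr => r /negbTE Sr; rewrite word_sigma_center // ffunE Sr.
by rewrite ffunE Sr digit_vecE scaler0.
Qed.

Lemma centroid_center_wordP (n : nat) (d1 : R) (b : word n) (S : {set 'I_n}) :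
  d1 != 0 -> S \subset word_supp b ->
  centroid_map d1 (center_word b S) =
    \sum_(r | r \notin S) (word_sigma R b r * side_scale d1 r) *: digit_vec R (b r)
  <-> forall r : 'I_n, r \notin S -> b r != D7 ->
        #|[set s in S | (s < r)%N]| = 0 %[mod 2].
Proof.
move=> d10 sSb; rewrite centroid_center_word //; split=> [|even_S]; last first.
  apply: eq_bigr => r Sr; have [->|br] := eqVneq (b r) D7.
    by rewrite digit_vecE !scaler0.
  by rewrite -signr_odd -[odd _]negbK -dvdn2 /dvdn even_S //= mulr1.
move=> /eqP; rewrite -subr_eq0 -sumrB => /eqP sum0.
pose T := [set r | [&& r \notin S, b r != D7 & odd #|[set s in S | (s < r)%N]|]].
have T0 : T = set0.
  (* At a position of [T] the sign flips, so the difference of the two terms is [-2] times the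
     original one; the scale absorbs this factor. *)
  apply: (@dyadic_sum_eq0 n b T (-2 * d1) (word_sigma R b)).
  - by rewrite mulf_neq0 // oppr_eq0 pnatr_eq0.
  - by apply/subsetP => r; rewrite !inE => /and3P[].
  - exact: word_sigma_norm.
  rewrite -[RHS]sum0 big_mkcond [RHS]big_mkcond; apply: eq_bigr => r _.
  rewrite inE -signr_odd; case: (r \in S) => //=.
  have [->|_] := eqVneq (b r) D7; first by rewrite digit_vecE !scaler0 subr0.
  case: (odd _) => /=; rewrite ?mulr1 ?subrr // -scalerBl.
  by congr (_ *: _); rewrite /side_scale; ring.
move=> r Sr br; have /setP/(_ r) := T0; rewrite !inE Sr br /= => ev.
by rewrite modn2 ev.
Qed.

End Plane.

Theorem theorem4p8 (R : realType) (n : nat) (hn : (1 <= n)%N)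
    (d1 : R) (hd1 : 0 < d1) (b : word n)
    (S : {set 'I_n}) (hS0 : S != set0) (hS : S \subset word_supp b) :
  let P0 := centroid_map d1 (word_gamma_iter b S 0) in
  let P1 := centroid_map d1 (word_gamma_iter b S 1) in
  let P2 := centroid_map d1 (word_gamma_iter b S 2) in
  let c := center_word b S in
  let Q := \sum_(r < n | r \notin S) (word_sigma R b r * side_scale d1 r) *: digit_vec R (b r) in
  (triangle_nondegenerate P0 P1 P2 /\ triangle_equilateral P0 P1 P2) /\
  signed_mul
    (signed_mul (pos_word (word_gamma_iter b S 0)) (pos_word (word_gamma_iter b S 1)))
    (pos_word (word_gamma_iter b S 2)) = ((-1) ^+ word_nu b, c) /\
  is_triangle_center P0 P1 P2 Q /\
  (centroid_map d1 c = Q <->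
   forall r : 'I_n, r \notin S -> b r != D7 ->
     #|[set s in S | (s < r)%N]| = 0 %[mod 2]).
Proof.
move=> P0 P1 P2 c Q.
have d10 : d1 != 0 by rewrite gt_eqF.
pose w := \sum_(r in S) (word_sigma R b r * side_scale d1 r) *: digit_vec R (b r).
have w0 : w != 0.
  (* If [w] vanished, [S] itself would be empty. *)
  by apply: contra_neq hS0; apply: dyadic_sum_eq0 => // r; apply: word_sigma_norm.
have -> : P0 = Q + w by rewrite /P0 centroid_gamma_iter expr0 mulmx1.
have -> : P1 = Q + w *m rot120 R by rewrite /P1 centroid_gamma_iter expr1.
have -> : P2 = Q + w *m rot120 R *m rot120 R.
  by rewrite /P2 centroid_gamma_iter expr2 -[_ * _]/(_ *m _) mulmxA.
split; first by split; [apply: rot120_nondegenerate | apply: rot120_equilateral].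
split; first exact: word_gamma_prod.
split; first exact: rot120_center.
exact: centroid_center_wordP.
Qed.
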